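(* Let $G$ be a nonempty graph that is a split graph or a cochordal graph. Then every vertex of $G$ of maximum degree (that is, every $x\in V(G)$ with $d_G(x)=\Delta(G)$) belongs to every longest path in $G$.
   Context: All graphs are finite and simple; $G$ is not assumed to be connected. A graph is nonempty if it contains at least one edge. A split graph is a graph whose vertex set can be partitioned into a clique and an independent set. A cochordal graph is a graph that is the complement of a chordal graph (a graph is chordal if it has no induced cycle of length at least four). A path $P$ in $G$ is a longest path in $G$ if there is no path in $G$ strictly longer than $P$. $\Delta(G)$ denotes the maximum degree of $G$. *)

(* Defs.v *)
From mathcomp Require Import all_boot.

Set Implicit Arguments.
Unset Strict Implicit.
Unset Printing Implicit Defensive.

(* A finite simple graph is a symmetric irreflexive relation on a finType;
   both properties are hypotheses of the theorem. *)
Section Graphs.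
Variables (V : finType) (e : rel V).

Definition nonempty_graph : Prop := exists x y : V, e x y.

Definition neighbours (x : V) : {set V} := [set y | e x y].
Definition degree (x : V) : nat := #|neighbours x|.
Definition max_degree : nat := \max_(x : V) degree x.

Definition is_clique (K : {set V}) : Prop :=
  {in K &, forall x y, x != y -> e x y}.
Definition is_independent (S : {set V}) : Prop :=
  {in S &, forall x y, ~~ e x y}.

(* Either part may be empty. *)
Definition split_graph : Prop :=
  exists K S : {set V},
    [/\ K :|: S = [set: V], K :&: S = set0, is_clique K & is_independent S].

(* The only edges between vertices of c are those joining cyclically
   consecutive ones. A single edge also qualifies, as a sequence of size 2;
   this is harmless since only sizes at least 4 are used below. *)
Definition induced_cycle (c : seq V) : Prop :=
  [/\ cycle e c, uniq c &
      {in c &, forall x y, e x y -> y = next c x \/ x = next c y}].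

Definition chordal : Prop :=
  ~ exists c : seq V, 4 <= size c /\ induced_cycle c.

Definition complement : rel V := fun x y => (x != y) && ~~ e x y.

(* A path is given by its nonempty sequence of pairwise distinct vertices. *)
Definition graph_path (p : seq V) : bool :=
  if p is x :: q then path e x q && uniq p else false.

(* Number of edges. *)
Definition path_length (p : seq V) : nat := (size p).-1.

Definition longest_path (p : seq V) : Prop :=
  graph_path p /\
  ~ exists q : seq V, graph_path q /\ path_length p < path_length q.

End Graphs.

Definition cochordal (V : finType) (e : rel V) : Prop :=
  exists f : rel V,
    [/\ symmetric f, irreflexive f, chordal f & e =2 complement f].

(* Main.v *)
Require Import Defs.
From mathcomp Require Import all_boot.

(** Split graphs and cochordal graphs contain no induced [2K_2]: of any two
    edges, some end of one is equal or adjacent to some end of the other.  The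
    argument below works for every nonempty graph with this property.

    Suppose that a longest path [p] avoids [x].  If [x] had a neighbour [y]
    outside [p], an end of the edge [x y] would be adjacent to an end of the
    first edge of [p], and [p] could be lengthened; hence all neighbours of [x]
    lie on [p].  The usual rerouting arguments show that every neighbour of [x]
    has a successor on [p] and that [x] together with these successors forms an
    independent set [A].  So [x] is joined to its neighbours, which are matched
    by [p] into [A :\ x].

    Such a configuration contradicts the maximality of the degree of [x]
    ([matched_neighbours_degree]).  Among the neighbours of [x] choose [v] with
    the most neighbours in [A].  For every neighbour [w] of [x], with successor
    [s w], the vertex [v] is adjacent to [s w] or to [w]: if [v] misses [s w],
    which [w] sees, then by the choice of [v] some [u] in [A] is seen by [v] and
    not by [w], and the edges [v u] and [w (s w)] can only be linked by [v w].
    Choosing one such vertex for each [w], and adding [x] itself, gives more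
    neighbours of [v] than [x] has. *)

Set Implicit Arguments.
Unset Strict Implicit.
Unset Printing Implicit Defensive.

(** * Graphs without induced [2K_2] *)

(** Two edges with a common end satisfy the conclusion trivially, so this
    constrains disjoint edges only, as the absence of an induced [2K_2] does. *)
Definition two_K2_free (V : finType) (e : rel V) : Prop :=
  forall a b c d, e a b -> e c d -> [|| e a c, e a d, e b c | e b d].

Section Graph.
Variables (V : finType) (e : rel V).
Hypotheses (e_sym : symmetric e) (e_irr : irreflexive e).

(** Each edge has an end in the clique, and the two ends so obtained are equal
    or adjacent. *)
Lemma split_two_K2_free : split_graph e -> two_K2_free e.
Proof.
move=> [K [S [KS _ clK indS]]] a b c d eab ecd.
have end_in_K u w : e u w -> (u \in K) || (w \in K).
  move=> euw; apply: contraTT (euw); rewrite negb_or => /andP[uK wK].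
  have inS t : t \notin K -> t \in S.
    by move=> tK; have := in_setT t; rewrite -KS inE (negPf tK).
  by apply: indS; exact: inS.
have adj_or_eq u w : u \in K -> w \in K -> (u == w) || e u w.
  by move=> uK wK; case: eqVneq => //= /(clK _ _ uK wK).
case/orP: (end_in_K _ _ eab) => [aK|bK];
  case/orP: (end_in_K _ _ ecd) => [cK|dK].
- case/orP: (adj_or_eq _ _ aK cK) => [/eqP ac|->//].
  by rewrite ac ecd orbT.
- case/orP: (adj_or_eq _ _ aK dK) => [/eqP ad|->]; last by rewrite orbT.
  by rewrite ad e_sym ecd.
- case/orP: (adj_or_eq _ _ bK cK) => [/eqP bc|->]; last by rewrite !orbT.
  by rewrite bc ecd !orbT.
- case/orP: (adj_or_eq _ _ bK dK) => [/eqP bd|->]; last by rewrite !orbT.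
  by rewrite bd (e_sym d c) ecd !orbT.
Qed.

(** The complement of an induced [2K_2] is an induced cycle of length 4. *)
Lemma cochordal_two_K2_free : cochordal e -> two_K2_free e.
Proof.
move=> [f [f_sym f_irr f_chordal ef]] a b c d eab ecd.
apply/negPn/negP; rewrite !negb_or => /and4P[ac ad bc bd]; apply: f_chordal.
have nonadj u w : ~~ e u w -> u != w -> f u w.
  by rewrite ef /complement => /[swap] -> /=; rewrite negbK.
have adj u w : e u w -> (u != w) && ~~ f u w by rewrite ef.
have /andP[ab fab] := adj _ _ eab; have /andP[cd fcd] := adj _ _ ecd.
have a_c : a != c by apply: contraNneq ad => ->.
have a_d : a != d by apply: contraNneq ac => ->; rewrite e_sym.
have b_c : b != c by apply: contraNneq bd => ->.
have b_d : b != d by apply: contraNneq bc => ->; rewrite e_sym.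
have neqE (u w : V) : u != w -> ((u == w) = false) * ((w == u) = false).
  by move=> uw; rewrite [w == u]eq_sym (negPf uw).
pose distinct := (neqE _ _ ab, neqE _ _ cd, neqE _ _ a_c, neqE _ _ a_d,
                  neqE _ _ b_c, neqE _ _ b_d).
exists [:: a; c; b; d]; split=> //; split.
- by rewrite /= (f_sym c) (f_sym d) !nonadj.
- by rewrite /= !inE !distinct.
- move: fab fcd => /negPf fab /negPf fcd y z.
  rewrite !inE => /or4P[]/eqP-> /or4P[]/eqP->;
    rewrite ?f_irr ?fab ?fcd ?(f_sym b a) ?(f_sym d c) ?fab ?fcd //;
    rewrite /next /= ?eqxx ?distinct; by [left | right].
Qed.

(** * A vertex of larger degree *)

(** The neighbour [v] of [x] with the most neighbours in the independent set
    meets every pair [{w, s w}].  These pairs are disjoint, because the [s w]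
    are not adjacent to [x], and they avoid [x]; with [x] itself they account
    for one neighbour of [v] more than [x] has. *)
Lemma matched_neighbours_degree (x : V) (s : V -> V) :
    two_K2_free e -> 0 < degree e x -> injective s ->
    (forall w, e x w -> e w (s w) && (s w != x)) ->
    is_independent e (x |: [set s w | w in neighbours e x]) ->
  exists v, degree e x < degree e v.
Proof.
move=> free /card_gt0P[v0 v0N] s_inj s_match; set A := _ |: _ => indA.
have xA : x \in A by rewrite setU11.
have ws w : e x w -> e w (s w) by case/s_match/andP.
have sA w : e x w -> s w \in A.
  by move=> xw; apply/setU1r/imset_f; rewrite inE.
pose deg_in_A v := #|neighbours e v :&: A|.
case: (@arg_maxnP _ v0 (mem (neighbours e x)) deg_in_A v0N) => v.
move=> /= xv v_max; exists v; rewrite inE in xv.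
have v_sees w : e x w -> ~~ e v (s w) -> e v w.
  move=> xw vsw.
  (* Otherwise [s w] would give [w] strictly more neighbours in [A] than [v]. *)
  have /subsetPn[u] : ~~ (neighbours e v :&: A \subset neighbours e w :&: A).
    apply/negP => sub_vw.
    have: neighbours e v :&: A \proper neighbours e w :&: A.
      apply/properP; split=> //; exists (s w).
        by rewrite in_setI inE ws ?sA.
      by rewrite in_setI inE (negPf vsw).
    move/proper_card; rewrite ltnNge; case/negP.
    by apply: v_max; rewrite /= inE.
  rewrite in_setI => /andP[+ uA]; rewrite in_setI uA andbT !inE => vu wu.
  (* [u] and [s w] are both in [A], so only the link [v w] remains. *)
  have := free _ _ _ _ vu (ws _ xw).
  rewrite (negPf vsw) (e_sym u w) (negPf wu).
  by rewrite (negPf (indA _ _ uA (sA _ xw))) !orbF.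
pose g w := if e v (s w) then s w else w.
have x_nsees w : e x w -> ~~ e x (s w) by move=> xw; apply: indA; rewrite ?sA.
have g_inj : {in neighbours e x &, injective g}.
  move=> w w'; rewrite !inE /g => xw xw'.
  case: (e v (s w)); case: (e v (s w')) => sw; [exact: s_inj | | | exact: sw].
    by have := x_nsees _ xw; rewrite sw xw'.
  by have := x_nsees _ xw'; rewrite -sw xw.
rewrite /degree -(card_in_imset g_inj).
have x_ng : x \notin g @: neighbours e x.
  apply/imsetP=> -[w]; rewrite inE /g => xw; case: ifP => _ xE.
    by case/andP: (s_match _ xw); rewrite -xE eqxx.
  by rewrite -xE e_irr in xw.
have <- : #|x |: g @: neighbours e x| = #|g @: neighbours e x|.+1.
  by rewrite cardsU1 x_ng.
apply/subset_leq_card/subsetP=> y; rewrite !inE => /predU1P[->|].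
  by rewrite e_sym.
case/imsetP=> w; rewrite inE /g => xw ->; case: ifP => // /negbT.
exact: v_sees.
Qed.

(** * Rerouting a longest path *)

Section LongestPath.
Variables (p : seq V) (x : V).
Hypotheses (p_longest : longest_path e p) (xp : x \notin p).

Lemma longest_path_max q : sorted e q -> uniq q -> size q <= size p.
Proof.
case: p_longest => p_path p_max q_path q_uniq; rewrite leqNgt.
apply/negP => lt_pq.
apply: p_max; exists q.
case: q p p_path q_path q_uniq lt_pq => [|a q] [|b r] //= _ q_path q_uniq lt_pq.
by rewrite /graph_path /path_length q_path.
Qed.

Lemma longest_path_sorted : sorted e p.
Proof. by case: p_longest; case: (p) => //= a q /andP[]. Qed.

Lemma longest_path_uniq : uniq p.
Proof. by case: p_longest; case: (p) => //= a q /andP[]. Qed.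

Lemma not_longer q : sorted e q -> uniq q -> size q = (size p).+1 -> False.
Proof. by move=> q_path /(longest_path_max q_path) + szq; rewrite szq ltnn. Qed.

Let p_path := longest_path_sorted.
Let p_uniq := longest_path_uniq.

(** Otherwise the edge [x y], disjoint from the path, is linked to the first
    edge [a b] of the path: a link to [a] puts one vertex in front of [a], and a
    link to [b] replaces [a] by both [x] and [y]. *)
Lemma neighbours_on_path y :
  two_K2_free e -> 1 < size p -> e x y -> y \in p.
Proof.
case: p p_path p_uniq xp not_longer => [|a [|b q]] //.
move=> /= /andP[ab bq_path] p_uniq' xp' longer free _ xy.
apply/negPn/negP => yp.
have x_y : x != y by apply: contraTneq xy => ->; rewrite e_irr.
have bq_uniq : uniq (b :: q) by case/andP: p_uniq'.
have xbq : x \notin b :: q by move: xp'; rewrite in_cons negb_or => /andP[].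
have ybq : y \notin b :: q by move: yp; rewrite in_cons negb_or => /andP[].
case/or4P: (free _ _ _ _ xy ab) => [xa|xb|ya|yb].
- apply: (longer (x :: a :: b :: q)) => //; first by rewrite /= xa ab.
  by rewrite cons_uniq xp'.
- apply: (longer (y :: x :: b :: q)) => //; first by rewrite /= e_sym xy xb.
  by rewrite !(cons_uniq, in_cons x) negb_or eq_sym x_y ybq xbq.
- apply: (longer (y :: a :: b :: q)) => //; first by rewrite /= ya ab.
  by rewrite cons_uniq yp.
- apply: (longer (x :: y :: b :: q)) => //; first by rewrite /= xy yb.
  by rewrite !(cons_uniq, in_cons y) negb_or x_y ybq xbq.
Qed.

(** Otherwise [x] could be inserted at the end of the path. *)
Lemma neighbour_has_successor p1 w p2 :
  p = p1 ++ w :: p2 -> e x w -> exists z p3, p2 = z :: p3.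
Proof.
case: p2 => [|z p3] def_p xw; last by exists z, p3.
case: (@not_longer (rcons p x)); last by rewrite size_rcons.
- move: p_path; rewrite -cats1 def_p -catA /= !sorted_cat_cons /= e_sym xw.
  by rewrite andbT.
- by rewrite rcons_uniq xp p_uniq.
Qed.

(** Otherwise [x] could be inserted between [w] and its successor. *)
Lemma successor_nonadjacent p1 w z p2 :
  p = p1 ++ w :: z :: p2 -> e x w -> ~~ e x z.
Proof.
move=> def_p xw; apply/negP => xz.
apply: (@not_longer (p1 ++ w :: x :: z :: p2)).
- move: p_path; rewrite def_p !sorted_cat_cons /= => /and3P[-> _ ->].
  by rewrite e_sym xw xz.
- have perm_px : perm_eq (p1 ++ w :: x :: z :: p2) (x :: p).
    apply/permP => a; rewrite def_p /= !count_cat /= [RHS]addnCA.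
    by congr (_ + _); rewrite addnCA.
  by rewrite (perm_uniq perm_px) /= xp p_uniq.
- by rewrite def_p !size_cat /= !addnS.
Qed.

(** Otherwise the path could be rerouted from [w] through [x] to [w'], back
    to [u], and from there directly to [u']. *)
Lemma successors_nonadjacent p1 w u p2 w' u' p3 :
  p = p1 ++ w :: u :: p2 ++ w' :: u' :: p3 -> e x w -> e x w' -> ~~ e u u'.
Proof.
move=> def_p xw xw'; apply/negP => uu'.
pose q := p1 ++ w :: x :: w' :: rev (u :: p2) ++ u' :: p3.
have perm_q : perm_eq q (x :: p).
  apply/permP => a; rewrite def_p /= !count_cat /= !count_cat count_rev /=.
  rewrite [RHS]addnCA; congr (_ + _); rewrite [RHS]addnCA; do 2 congr (_ + _).
  by rewrite addnCA -addnA.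
apply: (@not_longer q); last by rewrite (perm_size perm_q).
  move: p_path; rewrite def_p !sorted_cat_cons /= -cat_rcons cat_path last_rcons.
  case/and3P=> -> _ /andP[uw' /= /andP[_ u'p3]].
  rewrite e_sym xw xw' cat_path {2}rev_cons last_rcons /= uu' u'p3 !andbT /=.
  have := rev_path e u (rcons p2 w'); rewrite last_rcons belast_rcons => ->.
  by rewrite -(eq_path (e := e)).
by rewrite (perm_uniq perm_q) /= xp p_uniq.
Qed.

(** This allows the cyclic successor to serve as the matching: it is injective
    on all of [V], and it agrees with the successor along [p] except at the last
    vertex, which is not a neighbour of [x]. *)
Lemma next_successor p1 w z p2 : p = p1 ++ w :: z :: p2 -> next p w = z.
Proof.
move=> def_p.
by rewrite -(next_rot (size p1) p_uniq) def_p rot_size_cat /= eqxx.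
Qed.

Lemma neighbour_splits_path w :
  e x w -> w \in p -> exists p1 z p2, p = p1 ++ w :: z :: p2.
Proof.
move=> xw wp; case/splitPr def_p: {1}p / wp => [p1 p2].
have [z [p3 def_p2]] := neighbour_has_successor def_p xw.
by exists p1, z, p3; rewrite def_p2.
Qed.

Lemma next_neighbour w : e x w -> w \in p ->
  [/\ e w (next p w), ~~ e x (next p w) & next p w != x].
Proof.
move=> xw wp; have [p1 [z [p2 def_p]]] := neighbour_splits_path xw wp.
rewrite (next_successor def_p); split.
- by move: p_path; rewrite def_p sorted_cat_cons /= => /and3P[].
- exact: successor_nonadjacent def_p xw.
- by apply: contraNneq xp => <-; rewrite def_p mem_cat !inE eqxx !orbT.
Qed.

Lemma next_neighbours_nonadjacent w w' :
  e x w -> w \in p -> e x w' -> w' \in p -> ~~ e (next p w) (next p w').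
Proof.
wlog le_ww' : w w' / index w p <= index w' p => [hwlog|] xw wp xw' wp'.
  by case/orP: (leq_total (index w p) (index w' p)) => ?;
    [|rewrite e_sym]; apply: hwlog.
have [->|w_w'] := eqVneq w w'; first by rewrite e_irr.
have [p1 [u [p2 def_p]]] := neighbour_splits_path xw wp.
have xu := successor_nonadjacent def_p xw.
have w'p2 : w' \in p2.
  have w'_p1 : w' \notin p1.
    apply/negP => w'p1; move: le_ww'; rewrite def_p !index_cat w'p1.
    have /negPf-> : w \notin p1.
      move: p_uniq; rewrite def_p cat_uniq => /and3P[_ /hasPn wp1 _].
      by apply: wp1; rewrite inE eqxx.
    by rewrite leqNgt ltn_addr // index_mem.
  move: wp'; rewrite def_p mem_cat (negPf w'_p1) !inE eq_sym (negPf w_w') /=.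
  by case/predU1P=> // w'u; rewrite -w'u xw' in xu.
rewrite (next_successor def_p).
case/splitPr: w'p2 def_p => p21 p22 def_p.
have def_p' : p = (p1 ++ w :: u :: p21) ++ w' :: p22 by rewrite def_p -catA.
have [u' [p3 def_p22]] := neighbour_has_successor def_p' xw'.
rewrite def_p22 in def_p def_p'; rewrite (next_successor def_p').
exact: successors_nonadjacent def_p xw xw'.
Qed.

End LongestPath.
End Graph.

(** * Vertices of maximum degree *)

Theorem corollary1p2 (V : finType) (e : rel V)
  (e_sym : symmetric e) (e_irr : irreflexive e)
  (e_nonempty : nonempty_graph e)
  (e_class : split_graph e \/ cochordal e)
  (x : V) (x_max : degree e x = max_degree e)
  (p : seq V) (p_longest : longest_path e p) :
  x \in p.
Proof.
have free : two_K2_free e.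
  case: e_class; [exact: split_two_K2_free | exact: cochordal_two_K2_free].
have le_x v : degree e v <= degree e x by rewrite x_max; exact: leq_bigmax.
have [a [b ab]] := e_nonempty.
have x_gt0 : 0 < degree e x.
  by apply: leq_trans (le_x a); apply/card_gt0P; exists b; rewrite inE.
have p_gt1 : 1 < size p.
  apply: (longest_path_max p_longest (q := [:: a; b])); first by rewrite /= ab.
  by rewrite /= inE andbT; apply: contraTneq ab => ->; rewrite e_irr.
apply/negPn/negP => xp.
have on_p y : e x y -> y \in p.
  exact: (neighbours_on_path e_sym e_irr p_longest xp free p_gt1).
have nextP w (xw : e x w) := next_neighbour e_sym p_longest xp xw (on_p w xw).
have [v] : exists v, degree e x < degree e v; last by rewrite ltnNge le_x.
apply: (matched_neighbours_degree e_sym e_irr (s := next p)) => // [|w xw|].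
- exact/can_inj/prev_next/(longest_path_uniq p_longest).
- by have [-> _ ->] := nextP w xw.
- have x_next u : u \in [set next p w | w in neighbours e x] -> ~~ e x u.
    by case/imsetP=> w; rewrite inE => xw ->; have [] := nextP w xw.
  move=> u u' /setU1P[->|uN] /setU1P[->|u'N]; rewrite ?e_irr ?x_next //.
    by rewrite e_sym x_next.
  case/imsetP: uN u'N => w + -> /imsetP[w' + ->]; rewrite !inE => xw xw'.
  by apply: (next_neighbours_nonadjacent e_sym e_irr p_longest xp); rewrite ?on_p.
Qed.
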